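(* Let $X$ be a real Banach space such that every very smooth point of $X^\ast$ is a point of Fréchet differentiability of the norm of $X^\ast$ (i.e. a Fréchet smooth point of $X^\ast$), and let $Y$ be a real $L^1$-predual space. Suppose $T \in \mathcal{K}(X,Y)$ is a very smooth point of $\mathcal{K}(X,Y)$. Then $T$ is a Fréchet smooth point of $\mathcal{L}(X,Y)$.
   Context: $\mathcal{L}(X,Y)$ is the Banach space of bounded linear operators from $X$ to $Y$ with the operator norm and $\mathcal{K}(X,Y)$ its closed subspace of compact operators. An $L^1$-predual space is a Banach space $Y$ such that $Y^\ast$ is isometric to $L^1(\mu)$ for some positive measure $\mu$. For a Banach space $Z$, a non-zero $z \in Z$ is a smooth point of $Z$ if there is a unique norm-one $z_0^\ast \in Z^\ast$ with $z_0^\ast(z) = \|z\|$. A smooth point $z$ of $Z$ is very smooth if it is also a smooth point of $Z^{\ast\ast}$ (with $Z$ canonically embedded in $Z^{\ast\ast}$). A smooth point $z$ is Fréchet smooth if $\lim_{y \to 0} \frac{\|z+y\| - \|z\| - z_0^\ast(y)}{\|y\|} = 0$. *)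

(* Defs.v *)
From HB Require Import structures.
From mathcomp Require Import all_boot all_order all_algebra.
From mathcomp Require Import all_classical all_reals all_analysis.

Set Implicit Arguments.
Unset Strict Implicit.
Unset Printing Implicit Defensive.

Import Order.TTheory GRing.Theory Num.Theory.
Import numFieldNormedType.Exports.

Local Open Scope classical_set_scope.
Local Open Scope ring_scope.

Section BoundedOperators.
Context {R : realType} (X Y : normedModType R).

Definition bounded_operator : {pred X -> Y} :=
  [pred f | `[< linear f /\ bounded_fun_norm f >]].

Lemma bounded_operator_submod_closed : submod_closed bounded_operator.
Proof.
split.
  apply/asboolP; split=> [a x y|r]; first by rewrite /= scaler0 addr0.
  by exists 0 => x _; rewrite normr0.
move=> a f g /asboolP[lf bf] /asboolP[lg bg]; apply/asboolP; split.
  move=> k x y /=.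
  rewrite !fctE lf lg !scalerDr !scalerA [a * k]mulrC.
  by rewrite -!addrA; congr (_ + _); rewrite addrCA.
move=> r; have [M fM] := bf r; have [N gN] := bg r.
exists (`|a| * M + N) => x xr; rewrite !fctE.
rewrite (le_trans (ler_normD _ _))// lerD ?gN// normrZ.
by rewrite ler_wpM2l// fM.
Qed.

HB.instance Definition _ :=
  GRing.isSubmodClosed.Build _ _ bounded_operator bounded_operator_submod_closed.

Record boundedOp := BoundedOp {
  boundedOp_fun :> X -> Y ;
  boundedOpP : boundedOp_fun \in bounded_operator }.

HB.instance Definition _ := [isSub for boundedOp_fun].
HB.instance Definition _ := [Choice of boundedOp by <:].
HB.instance Definition _ := [SubChoice_isSubLmodule of boundedOp by <:].

Lemma boundedOp_linear (T : boundedOp) : linear T.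
Proof. by have /asboolP[] := boundedOpP T. Qed.

Lemma boundedOp0 (T : boundedOp) : T 0 = 0.
Proof.
have /(_ (-1) 0 0) := @boundedOp_linear T.
by rewrite scaler0 addr0 scaleN1r addNr.
Qed.

Lemma boundedOpZ (T : boundedOp) a x : T (a *: x) = a *: T x.
Proof. by rewrite -[a *: x]addr0 boundedOp_linear boundedOp0 addr0. Qed.

Definition opnorm (T : boundedOp) : R :=
  sup [set `|T x| | x in [set x : X | `|x| <= 1]].

Lemma opnorm_has_sup (T : boundedOp) :
  has_sup [set `|T x| | x in [set x : X | `|x| <= 1]].
Proof.
split; first by exists `|T 0|, 0 => //=; rewrite normr0.
have /asboolP[_ /(_ 1)[M TM]] := boundedOpP T.
by exists M => _ [x /= x1 <-]; exact: TM.
Qed.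

Lemma opnorm_ub (T : boundedOp) x : `|x| <= 1 -> `|T x| <= opnorm T.
Proof. by move=> x1; apply: sup_upper_bound; [exact: opnorm_has_sup|exists x]. Qed.

Lemma opnorm_le (T : boundedOp) M :
  (forall x, `|x| <= 1 -> `|T x| <= M) -> opnorm T <= M.
Proof.
move=> TM; apply: ge_sup; first by have [] := opnorm_has_sup T.
by move=> _ [x /= x1 <-]; exact: TM.
Qed.

Lemma opnorm_ge0 (T : boundedOp) : 0 <= opnorm T.
Proof. by rewrite (le_trans _ (@opnorm_ub T 0 _)) ?normr0. Qed.

Lemma ler_opnorm (T : boundedOp) x : `|T x| <= opnorm T * `|x|.
Proof.
have [->|x0] := eqVneq x 0; first by rewrite boundedOp0 !normr0 mulr0.
have nx0 : 0 < `|x| by rewrite normr_gt0.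
have := @opnorm_ub T (`|x|^-1 *: x).
rewrite boundedOpZ !normrZ normfV normr_id mulVf ?gt_eqF// => /(_ (lexx _)).
by rewrite mulrC ler_pdivrMr.
Qed.

Lemma opnormD (S T : boundedOp) : opnorm (S + T) <= opnorm S + opnorm T.
Proof.
apply: opnorm_le => x x1.
by rewrite (le_trans (ler_normD _ _))// lerD// opnorm_ub.
Qed.

Lemma opnormZ (a : R) (T : boundedOp) : opnorm (a *: T) = `|a| * opnorm T.
Proof.
have le_opnormZ b S : opnorm (b *: S) <= `|b| * opnorm S.
  by apply: opnorm_le => x x1; rewrite normrZ ler_wpM2l// opnorm_ub.
apply/eqP; rewrite eq_le le_opnormZ/=.
have [->|a0] := eqVneq a 0; first by rewrite normr0 mul0r opnorm_ge0.
rewrite -ler_pdivlMl ?normr_gt0// -normfV (le_trans _ (le_opnormZ _ _))//.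
by rewrite scalerA mulVf// scale1r.
Qed.

Lemma opnorm_eq0 (T : boundedOp) : opnorm T = 0 -> T = 0.
Proof.
move=> T0; apply/val_inj/funext => x /=; apply/eqP; rewrite -normr_le0.
by rewrite (le_trans (ler_opnorm T x))// T0 mul0r.
Qed.

HB.instance Definition _ :=
  Lmodule_isNormed.Build R boundedOp opnormD opnormZ opnorm_eq0.

End BoundedOperators.

Section CompactOperators.
Context {R : realType} (X Y : normedModType R).

(* [precompact] is relative compactness: the closure is compact. *)
Definition compact_operator : {pred boundedOp X Y} :=
  [pred T : boundedOp X Y | `[< precompact (T @` [set x : X | `|x| <= 1]) >]].

Lemma compact_operator_submod_closed : submod_closed compact_operator.
Proof.
have normed_hausdorff : hausdorff_space Y by exact: norm_hausdorff.
split.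
  apply/asboolP; apply: (@precompact_subset _ _ [set 0]).
    by move=> _ [x _ <-].
  rewrite precompact_closed; first exact: compact_set1.
  exact/accessible_closed_set1/hausdorff_accessible.
move=> a S T /asboolP; rewrite precompactE => cS.
move=> /asboolP; rewrite precompactE => cT; apply/asboolP.
pose h (p : Y * Y) := a *: p.1 + p.2.
set A := closure _ in cS; set B := closure _ in cT.
have ch : continuous h.
  move=> p; apply: cvgD; last exact: cvg_snd.
  by apply: cvgZr; exact: cvg_fst.
have cAB : compact (h @` (A `*` B)).
  apply: continuous_compact; last exact: compact_setX.
  exact: continuous_subspaceT.
apply: (@precompact_subset _ _ (h @` (A `*` B))).
  move=> _ [x x1 <-]; exists (S x, T x) => //.
  by split; apply: subset_closure; exists x.
by rewrite precompact_closed//; exact: compact_closed.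
Qed.

HB.instance Definition _ :=
  GRing.isSubmodClosed.Build _ _ compact_operator compact_operator_submod_closed.

Record compactOp := CompactOp {
  compactOp_op :> boundedOp X Y ;
  compactOpP : compactOp_op \in compact_operator }.

HB.instance Definition _ := [isSub for compactOp_op].
HB.instance Definition _ := [Choice of compactOp by <:].
HB.instance Definition _ := [SubChoice_isSubLmodule of compactOp by <:].

Let knorm (T : compactOp) : R := `|compactOp_op T|.

Let knormD S T : knorm (S + T) <= knorm S + knorm T.
Proof. exact: ler_normD. Qed.

Let knormZ (a : R) T : knorm (a *: T) = `|a| * knorm T.
Proof. exact: normrZ. Qed.

Let knorm_eq0 T : knorm T = 0 -> T = 0.
Proof. by move=> /normr0_eq0 T0; exact: val_inj. Qed.

HB.instance Definition _ :=
  Lmodule_isNormed.Build R compactOp knormD knormZ knorm_eq0.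

End CompactOperators.

Section SmoothPoints.
Context {R : realType} (Z : normedModType R).
Local Notation "E '^star'" := (boundedOp E R^o) (at level 2, format "E '^star'").
Implicit Types (z : Z) (f : Z^star).

Lemma evaluation_bounded z :
  (fun f => f z : R^o) \in @bounded_operator R Z^star R^o.
Proof.
apply/asboolP; split=> [a f g //|r]; exists (r * `|z|) => f fr.
by rewrite (le_trans (ler_opnorm f z))// ler_wpM2r.
Qed.

Definition bidual_embedding z : Z^star^star := BoundedOp (evaluation_bounded z).

Definition norming z f : Prop := `|f| = 1 /\ f z = `|z|.

Definition smooth_point z : Prop := z != 0 /\ exists! f, norming z f.

Definition frechet_smooth_point z : Prop :=
  smooth_point z /\
  exists2 f, norming z f &
    (`|z + y| - `|z| - f y) / `|y| @[y --> (0 : Z)^'] --> (0 : R).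

End SmoothPoints.

Definition very_smooth_point {R : realType} (Z : normedModType R) (z : Z) : Prop :=
  smooth_point z /\ smooth_point (bidual_embedding z).

(* The elements of [LspaceType1 mu] are classes modulo almost everywhere
   equality; the library puts no linear structure on this quotient, so the
   linearity of [J] is expressed almost everywhere on representatives. *)
Definition isometric_to_L1 {R : realType} (V : normedModType R)
    (d : measure_display) (T : measurableType d)
    (mu : {measure set T -> \bar R}) : Prop :=
  exists J : V -> LspaceType1 mu,
    [/\ forall (a : R) (u v : V),
          (J (a *: u + v) : T -> R) = (fun t => a * J u t + J v t) %[ae mu],
        forall v : V, 'N[mu]_1[EFin \o J v]%E = `|v|%:E
      & forall h : LspaceType1 mu, exists v : V, J v = h].

Definition L1_predual {R : realType} (Y : normedModType R) : Prop :=
  exists (d : measure_display) (T : measurableType d)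
    (mu : {measure set T -> \bar R}), isometric_to_L1 (boundedOp Y R^o) mu.

(* Main.v *)
Require Import Defs.
From HB Require Import structures.
From mathcomp Require Import all_boot all_order all_algebra.
From mathcomp Require Import all_classical all_reals all_analysis.
From mathcomp Require Import measurable_realfun ring lra.

(* A compact [T] attains [|T* e| = |T|] at some norm-one [e] of [Y* = L1(mu)].
   If [F] norms [T* e], then [S |-> F (S* e)] norms [T], so smoothness of [T]
   forces [e] to be an extreme point of the unit ball, i.e. a normalised atom;
   hence [Y*] is the l1-sum of [R e] and [ker p] for some [p] in [Y**].
   Very smoothness of [T] gives [c < |T|] with [|T* n| <= c |n|] on [ker p]:
   otherwise [T] would also be normed, in the third dual of [K(X, Y)], by a
   cluster point of functionals [S |-> n_k (S x_k)] with [n_k] in [ker p].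
   Consequently [|T + S| = |T* e + S* e|] for small [S], and the
   differentiability of the norm at [T* e], which is a very smooth point of
   [X*], carries over to [T]. *)

Set Implicit Arguments.
Unset Strict Implicit.
Unset Printing Implicit Defensive.
Import Order.TTheory GRing.Theory Num.Theory.
Import numFieldNormedType.Exports.
Local Open Scope classical_set_scope.
Local Open Scope ring_scope.

(** * Hahn-Banach *)

Section HahnBanach.
Context {R : realType} (V : lmodType R).

Definition sublinear (p : V -> R) :=
  (forall x y, p (x + y) <= p x + p y) /\
  (forall a x, 0 <= a -> p (a *: x) <= a * p x).

Lemma sublinear0 p : sublinear p -> p 0 = 0.
Proof.
move=> [pD pZ]; have := pZ 0 0 (lexx 0); have := pD 0 0.
by rewrite addr0 scaler0 mul0r; lra.
Qed.

Lemma sublinear_geN p x : sublinear p -> - p (- x) <= p x.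
Proof.
by move=> sp; have := sp.1 x (- x); rewrite subrr (sublinear0 sp); lra.
Qed.

(* A sublinear minorant of [p]; if it equals [p] for every [z] then [p] is
   additive, so that minimal sublinear functionals are linear. *)
Definition tilt (p : V -> R) z x :=
  inf [set p (x + t *: z) - t * p z | t in [set t | 0 <= t]].

Lemma tilt_lbound p z x : sublinear p ->
  lbound [set p (x + t *: z) - t * p z | t in [set t | 0 <= t]] (- p (- x)).
Proof.
move=> sp _ [t /= t0 <-].
have := sp.1 (x + t *: z) (- x); rewrite addrAC subrr add0r => h.
(* [sublinear] only bounds [p (t *: z)] from above; the reverse inequality comes from scaling back
   by [t^-1]. *)
have : t * p z <= p (t *: z).
  have [->|tn0] := eqVneq t 0; first by rewrite mul0r scale0r sublinear0.
  rewrite -ler_pdivlMl ?lt0r ?tn0//.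
  have := sp.2 t^-1 (t *: z); rewrite scalerA mulVf// scale1r; apply.
  by rewrite invr_ge0.
lra.
Qed.

Lemma tilt_le p z x t : sublinear p -> 0 <= t ->
  tilt p z x <= p (x + t *: z) - t * p z.
Proof.
move=> sp t0; apply: ge_inf; last by exists t.
by exists (- p (- x)); exact: tilt_lbound.
Qed.

Lemma le_tilt p z x c :
  (forall t, 0 <= t -> c <= p (x + t *: z) - t * p z) -> c <= tilt p z x.
Proof.
move=> h; apply: lb_le_inf; first by exists (p (x + 0 *: z) - 0 * p z), 0 => /=.
by move=> _ [t /= t0 <-]; exact: h.
Qed.

(** Parameters [t] for [x] and [s] for [y] combine into [t + s] for [x + y], and [t] for [x] becomes
    [a * t] for [a *: x]. *)
Lemma tilt_sublinear p z : sublinear p -> sublinear (tilt p z).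
Proof.
move=> sp; split=> [x y|a x].
  rewrite -lerBlDr; apply: le_tilt => t t0; rewrite lerBlDr -lerBlDl.
  apply: le_tilt => s s0; rewrite lerBlDl.
  have st0 : 0 <= t + s by rewrite addr_ge0.
  apply: le_trans (tilt_le z (x + y) sp st0) _.
  have := sp.1 (x + t *: z) (y + s *: z).
  by rewrite addrACA -scalerDl; lra.
rewrite le_eqVlt => /predU1P[<-|a0].
  rewrite scale0r mul0r; apply: le_trans (tilt_le z 0 sp (lexx 0)) _.
  by rewrite scale0r addr0 (sublinear0 sp) mul0r subrr.
rewrite -ler_pdivrMl//; apply: le_tilt => t t0; rewrite ler_pdivrMl//.
have at0 : 0 <= a * t by rewrite mulr_ge0// ltW.
apply: le_trans (tilt_le z (a *: x) sp at0) _.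
have := sp.2 a (x + t *: z) (ltW a0); rewrite scalerDr scalerA.
by rewrite mulrBr mulrA; lra.
Qed.

(** Zorn's lemma gives a pointwise minimal sublinear functional below [q]. No values are prescribed
    on a subspace: an application encodes them in the choice of [q]. *)
Theorem hahn_banach_sublinear q : sublinear q ->
  exists f : V -> R, linear (f : V -> R^o) /\ forall x, f x <= q x.
Proof.
move=> sq.
pose S := {p : V -> R | sublinear p /\ forall x, p x <= q x}.
(* The order is reversed: a maximal element for [r] is a pointwise minimal functional. *)
pose r : rel S := fun p p' => `[< forall x, sval p' x <= sval p x >].
have [|a b c /asboolP ba /asboolP ac|a b /asboolP ab /asboolP ba|A totA|m mmin] :=
  @Zorn S r.
- by move=> s; apply/asboolP.
- by apply/asboolP => x; exact: le_trans (ac x) (ba x).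
- apply: eq_sig_hprop => /=; first by move=> p; exact: Prop_irrelevance.
  by apply/funext => x; apply/eqP; rewrite eq_le ab ba.
- have [A0|/set0P[s0 As0]] := eqVneq A set0.
    by exists (exist _ q (conj sq (fun=> lexx _))) => s; rewrite A0.
  (* The chain is bounded by its pointwise infimum, which is finite since every member is at least
     [- q (- x)] at [x]. *)
  pose E x := [set sval s x | s in A]; pose p x := inf (E x).
  have pS s x : A s -> p x <= sval s x.
    move=> As; apply: ge_inf; last by exists s.
    exists (- q (- x)) => _ [[u [su uq]] _ <-] /=.
    by apply: le_trans (sublinear_geN x su); rewrite lerN2.
  have Sp c x : (forall s, A s -> c <= sval s x) -> c <= p x.
    move=> h; apply: lb_le_inf; first by exists (sval s0 x), s0.
    by move=> _ [s As <-]; exact: h.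
  have sp : sublinear p.
    split=> [x y|a x a0].
      rewrite -lerBlDr; apply: (Sp) => s As; rewrite lerBlDr -lerBlDl.
      apply: (Sp) => u Au; rewrite lerBlDl.
      (* The smaller of the two members of the chain serves for both [x] and [y]. *)
      have [su|us] := totA _ _ As Au.
        apply: le_trans (pS _ _ Au) _; apply: le_trans ((svalP u).1.1 _ _) _.
        by rewrite lerD2r; exact: (asboolP _ su).
      apply: le_trans (pS _ _ As) _; apply: le_trans ((svalP s).1.1 _ _) _.
      by rewrite lerD2l; exact: (asboolP _ us).
    move: a0; rewrite le_eqVlt => /predU1P[<-|a0].
      rewrite scale0r mul0r; apply: le_trans (pS _ _ As0) _.
      by rewrite sublinear0//; exact: (svalP s0).1.
    rewrite -ler_pdivrMl//; apply: (Sp) => s As; rewrite ler_pdivrMl//.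
    by apply: le_trans (pS _ _ As) _; apply: (svalP s).1.2; exact: ltW.
  have pq x : p x <= q x by apply: le_trans (pS _ _ As0) _; exact: (svalP s0).2.
  by exists (exist _ p (conj sp pq)) => s As; apply/asboolP => x /=; exact: pS.
move: m mmin => [m [sm mq]] mmin.
have mD x z : m (x + z) = m x + m z.
  have tm u : tilt m z u <= m u.
    apply: le_trans (tilt_le z u sm (lexx 0)) _.
    by rewrite scale0r addr0 mul0r subr0.
  have := mmin (exist _ (tilt m z) (conj (tilt_sublinear z sm)
    (fun u => le_trans (tm u) (mq u)))).
  move=> /(_ (introT (asboolP _) tm)) /(congr1 sval) /= tE.
  apply/eqP; rewrite eq_le sm.1/=.
  (* Since [tilt m z = m], the parameter [t = 1] gives [m x + m z <= m (x + z)]. *)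
  by have := tilt_le z x sm ler01; rewrite tE scale1r; lra.
have mN x : m (- x) = - m x.
  by have := mD x (- x); rewrite subrr (sublinear0 sm); lra.
have mZ a x : 0 <= a -> m (a *: x) = a * m x.
  move=> a0; apply/eqP; rewrite eq_le sm.2//=.
  by have := sm.2 a (- x) a0; rewrite scalerN !mN mulrN lerN2.
exists m; split=> // a x y; rewrite mD; congr (_ + _).
have [a0|a0] := leP 0 a; first exact: mZ.
by rewrite -[a]opprK scaleNr mN mZ ?oppr_ge0 ?ltW// scaleNr.
Qed.

End HahnBanach.

(** * Operator norm bounds and norming functionals *)

Section DualNorm.
Context {R : realType}.
Implicit Types V W : normedModType R.

Lemma boundedOp_ext V W (f g : boundedOp V W) : (forall x, f x = g x) -> f = g.
Proof. by move=> fg; apply/val_inj/funext. Qed.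

Lemma bounded_operator_of_le V W (f : V -> W) M : linear f ->
  (forall x, `|f x| <= M * `|x|) -> f \in @bounded_operator R V W.
Proof.
move=> lf fM; apply/asboolP; split=> // r; exists (`|M| * r) => x xr.
apply: le_trans (fM x) _; apply: le_trans (ler_norm _) _.
by rewrite normrM normr_id ler_wpM2l.
Qed.

Definition mk_op V W (f : V -> W) M (lf : linear f)
  (fM : forall x, `|f x| <= M * `|x|) : boundedOp V W :=
  BoundedOp (bounded_operator_of_le lf fM).

Lemma op_norm_le V W (f : boundedOp V W) M : 0 <= M ->
  (forall x, `|f x| <= M * `|x|) -> `|f| <= M.
Proof.
move=> M0 fM; apply: opnorm_le => x x1; apply: le_trans (fM x) _.
by rewrite ler_piMr.
Qed.

Lemma op_ler_norm V W (f : boundedOp V W) x : `|f x| <= `|f| * `|x|.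
Proof. exact: ler_opnorm. Qed.

(** Hahn-Banach is applied to the norm tilted by [z]. The parameter [t = 1] at the point [- z] then
    forces [f (- z) <= - |z|], while [t = 0] gives [f <= |.|]. *)
Lemma norming_exists V (z : V) : z != 0 -> exists f, norming z f.
Proof.
move=> z0; pose q := tilt (fun x : V => `|x|) z.
have sn : sublinear (fun x : V => `|x|).
  by split=> [x y|a x a0]; [exact: ler_normD|rewrite normrZ ger0_norm].
have [f [lf fq]] := hahn_banach_sublinear (tilt_sublinear z sn).
have fn x : f x <= `|x|.
  apply: le_trans (fq x) (le_trans (tilt_le z x sn (lexx 0)) _).
  by rewrite scale0r addr0 mul0r subr0.
have f0 : f 0 = 0 by have := lf 1 0 0; rewrite scaler0 addr0 scale1r; lra.
have fN x : f (- x) = - f x.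
  by have := lf (-1) x 0; rewrite addr0 scaleN1r f0 addr0 scaleN1r.
have fM x : `|f x : R^o| <= 1 * `|x|.
  by rewrite mul1r ler_norml fn andbT lerNl -fN -normrN fn.
pose F : boundedOp V R^o := mk_op lf fM.
have Fz : F z = `|z|.
  apply/eqP; rewrite eq_le fn/=.
  have := le_trans (fq (- z)) (tilt_le z (- z) sn ler01).
  by rewrite scale1r addNr normr0 fN mul1r; lra.
exists F; split => //; apply/eqP; rewrite eq_le op_norm_le//=.
have zp : 0 < `|z| by rewrite normr_gt0.
have := op_ler_norm F z; rewrite Fz normr_id.
by rewrite -ler_pdivrMr// divff ?gt_eqF.
Qed.

End DualNorm.

(** * Operators and adjoints *)

Section Adjoints.
Context {R : realType}.
Local Notation "E '^star'" := (boundedOp E R^o) (at level 2, format "E '^star'").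
Implicit Types V W U X Y : normedModType R.

Lemma compactOpE V W a (f g : compactOp V W) x :
  (a *: f + g) x = a *: f x + g x.
Proof. by []. Qed.

Lemma comp_bounded V W U (g : boundedOp W U) (f : boundedOp V W) x :
  `|g (f x)| <= (`|g| * `|f|) * `|x|.
Proof.
apply: le_trans (op_ler_norm _ _) _.
by rewrite -mulrA ler_wpM2l// op_ler_norm.
Qed.

Lemma comp_linear V W U (g : boundedOp W U) (f : boundedOp V W) :
  linear (fun x => g (f x)).
Proof. by move=> a x y; rewrite !boundedOp_linear. Qed.

Definition comp_op V W U (g : boundedOp W U) (f : boundedOp V W) :=
  mk_op (comp_linear g f) (comp_bounded g f).

Lemma norm_comp_op V W U (g : boundedOp W U) (f : boundedOp V W) :
  `|comp_op g f| <= `|g| * `|f|.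
Proof.
by apply: (@op_norm_le _ _ _ (comp_op g f)); [rewrite mulr_ge0|exact: comp_bounded].
Qed.

Lemma precomp_linear V W U (f : boundedOp V W) :
  linear (fun g : boundedOp W U => comp_op g f).
Proof. by move=> a g h; apply: boundedOp_ext. Qed.

Lemma precomp_bounded V W U (f : boundedOp V W) (g : boundedOp W U) :
  `|comp_op g f| <= `|f| * `|g|.
Proof. by rewrite mulrC norm_comp_op. Qed.

Definition adjoint V W (f : boundedOp V W) : boundedOp (W^star) (V^star) :=
  mk_op (@precomp_linear V W R^o f) (@precomp_bounded V W R^o f).

Lemma norm_adjoint V W (f : boundedOp V W) : `|adjoint f| <= `|f|.
Proof. by apply: op_norm_le => // g; exact: precomp_bounded. Qed.

Lemma postcomp_linear V W U (g : boundedOp W U) :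
  linear (fun f : boundedOp V W => comp_op g f).
Proof. by move=> a f h; apply: boundedOp_ext => x /=; rewrite boundedOp_linear. Qed.

Definition postcomp V W U (g : boundedOp W U) :
    boundedOp (boundedOp V W) (boundedOp V U) :=
  mk_op (@postcomp_linear V W U g) (@norm_comp_op V W U g).

Lemma norm_postcomp V W U (g : boundedOp W U) : `|postcomp V g| <= `|g|.
Proof. by apply: op_norm_le => // f; exact: norm_comp_op. Qed.

Lemma compact_incl_linear V W : linear (@compactOp_op R V W).
Proof. by []. Qed.

Lemma compact_incl_bounded V W (f : compactOp V W) :
  `|compactOp_op f| <= 1 * `|f|.
Proof. by rewrite mul1r. Qed.

Definition compact_incl V W : boundedOp (compactOp V W) (boundedOp V W) :=
  mk_op (@compact_incl_linear V W) (@compact_incl_bounded V W).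

Lemma norm_compact_incl V W : `|compact_incl V W| <= 1.
Proof. by apply: op_norm_le => // f; exact: compact_incl_bounded. Qed.

Lemma rank_one_linear V W (f : V^star) (w : W) : linear (fun x => f x *: w).
Proof. by move=> a x y; rewrite boundedOp_linear scalerDl scalerA. Qed.

Lemma rank_one_bounded V W (f : V^star) (w : W) x :
  `|f x *: w| <= (`|f| * `|w|) * `|x|.
Proof.
rewrite normrZ mulrAC ler_wpM2r//; exact: op_ler_norm.
Qed.

Definition rank_one_op V W (f : V^star) (w : W) : boundedOp V W :=
  mk_op (rank_one_linear f w) (rank_one_bounded f w).

(** The image of the unit ball lies in the image of the segment [[- |f|, |f|]] under [t |-> t *: w],
    which is compact. *)
Lemma rank_one_compact V W (f : V^star) (w : W) :
  rank_one_op f w \in @compact_operator R V W.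
Proof.
apply/asboolP; pose h (t : R) : W := t *: w.
have ch : {within `[- `|f|, `|f|], continuous h}.
  apply: continuous_subspaceT => t; apply: cvgZl; exact: cvg_id.
have cA := continuous_compact ch (@segment_compact R _ _).
apply: (@precompact_subset _ _ (h @` `[- `|f|, `|f|])).
  move=> _ [x x1 <-]; exists (f x) => //=.
  rewrite in_itv/= -ler_norml; apply: le_trans (op_ler_norm f x) _.
  by rewrite ler_piMr.
by rewrite precompact_closed//; apply: compact_closed => //; exact: norm_hausdorff.
Qed.

Definition rank_one V W (f : V^star) (w : W) : compactOp V W :=
  CompactOp (rank_one_compact f w).

Lemma norm_rank_one V W (f : V^star) (w : W) : `|rank_one f w| <= `|f| * `|w|.
Proof.
apply: (@op_norm_le _ _ _ (rank_one_op f w)); first by rewrite mulr_ge0.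
exact: rank_one_bounded.
Qed.

Lemma compactOp_ext V W (f g : compactOp V W) : (forall x, f x = g x) -> f = g.
Proof. by move=> fg; apply/val_inj/boundedOp_ext. Qed.

Lemma rank_one_linearl V W (w : W) : linear (fun f : V^star => rank_one f w).
Proof.
move=> a f g; apply: compactOp_ext => x.
by rewrite compactOpE /= -[LHS]/((a * f x + g x) *: w) scalerDl scalerA.
Qed.

Lemma rank_one_linearr V W (f : V^star) : linear (fun w : W => rank_one f w).
Proof.
move=> a w v; apply: compactOp_ext => x.
rewrite compactOpE.
by rewrite /= scalerDr !scalerA mulrC.
Qed.

Lemma rank_one_boundedl V W (w : W) (f : V^star) :
  `|rank_one f w| <= `|w| * `|f|.
Proof. by rewrite mulrC norm_rank_one. Qed.

(** When [g w = 1], this is a right inverse of [S |-> S* g], as the smoothness transfer requires. *)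
Definition rank_onel V W (w : W) : boundedOp (V^star) (compactOp V W) :=
  mk_op (@rank_one_linearl V W w) (@rank_one_boundedl V W w).

Definition rank_oner V W (f : V^star) : boundedOp W (compactOp V W) :=
  mk_op (@rank_one_linearr V W f) (@norm_rank_one V W f).

End Adjoints.

(** * Transfer of smoothness *)

Section SmoothTransfer.
Context {R : realType}.
Local Notation "E '^star'" := (boundedOp E R^o) (at level 2, format "E '^star'").
Implicit Types V W : normedModType R.

Lemma functional_le_norm V (f : V^star) x : f x <= `|f| * `|x|.
Proof. exact: le_trans (ler_norm _) (op_ler_norm f x). Qed.

Lemma boundedOpD V W (f : boundedOp V W) x y : f (x + y) = f x + f y.
Proof. by rewrite -[x]scale1r boundedOp_linear !scale1r. Qed.

Lemma boundedOpN V W (f : boundedOp V W) x : f (- x) = - f x.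
Proof. by rewrite -scaleN1r boundedOpZ scaleN1r. Qed.

Lemma boundedOpB V W (f : boundedOp V W) x y : f (x - y) = f x - f y.
Proof. by rewrite boundedOpD boundedOpN. Qed.

Lemma norming_of_le V (z : V) (f : V^star) :
  z != 0 -> `|f| <= 1 -> f z = `|z| -> norming z f.
Proof.
move=> z0 f1 fz; split=> //; apply/eqP; rewrite eq_le f1/=.
have zp : 0 < `|z| by rewrite normr_gt0.
have := functional_le_norm f z; rewrite fz.
by rewrite -ler_pdivrMr// divff ?gt_eqF.
Qed.

Lemma norm_bidual_embedding V (z : V) : `|bidual_embedding z| = `|z|.
Proof.
apply/eqP; rewrite eq_le; apply/andP; split.
  by apply: op_norm_le => // f; rewrite mulrC; exact: (op_ler_norm f).
have [->|z0] := eqVneq z 0; first by rewrite normr0.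
have [f [f1 fz]] := norming_exists z0.
by have := functional_le_norm (bidual_embedding z) f; rewrite /= fz f1 mulr1.
Qed.

Lemma adjoint_norming V W (A : boundedOp V W) v F : `|A| <= 1 ->
  `|A v| = `|v| -> v != 0 -> norming (A v) F -> norming v (adjoint A F).
Proof.
move=> A1 Av v0 [F1 FAv]; apply: norming_of_le => //.
  by apply: le_trans (norm_comp_op _ _) _; rewrite F1 mul1r.
by rewrite -Av.
Qed.

(** Functionals norming [A v] pull back along [A] to functionals norming [v], hence to the same one;
    the right inverse [B] makes the adjoint of [A] injective. *)
Lemma smooth_point_transfer V W (A : boundedOp V W) (B : boundedOp W V) v :
  `|A| <= 1 -> (forall w, A (B w) = w) -> `|A v| = `|v| ->
  smooth_point v -> smooth_point (A v).
Proof.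
move=> A1 AB Av [v0 [f [_ funi]]].
have Av0 : A v != 0 by rewrite -normr_eq0 Av normr_eq0.
split=> //; have [F nF] := norming_exists Av0.
exists F; split=> // G nG; apply: boundedOp_ext => w.
have /(congr1 (fun h : V^star => h (B w))) :
    adjoint A F = adjoint A G.
  rewrite -(funi _ (adjoint_norming A1 Av v0 nF)).
  exact: funi (adjoint_norming A1 Av v0 nG).
by rewrite /= AB.
Qed.

(** The second adjoint of [A] sends the canonical image of [v] to that of [A v] and has the second
    adjoint of [B] as right inverse, so the transfer of smoothness applies a second time. *)
Lemma very_smooth_point_transfer V W (A : boundedOp V W) (B : boundedOp W V) v :
  `|A| <= 1 -> (forall w, A (B w) = w) -> `|A v| = `|v| ->
  very_smooth_point v -> very_smooth_point (A v).
Proof.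
move=> A1 AB Av [sv sv2]; split; first exact: smooth_point_transfer AB Av sv.
have E : bidual_embedding (A v) = adjoint (adjoint A) (bidual_embedding v).
  exact: boundedOp_ext.
rewrite E; apply: (@smooth_point_transfer _ _ _ (adjoint (adjoint B))) => //.
- exact: le_trans (norm_adjoint _) (le_trans (norm_adjoint _) A1).
- move=> w; apply: boundedOp_ext => f; congr (w _).
  by apply: boundedOp_ext => x /=; rewrite AB.
- by rewrite -E !norm_bidual_embedding.
Qed.

(** A form without quotient, in which [s = 0] needs no exclusion. *)
Definition frechet_norm_derivative V (z : V) (f : V^star) :=
  forall e, 0 < e ->
  \forall s \near (0 : V), `| `|z + s| - `|z| - f s| <= e * `|s|.

Lemma frechet_norm_derivativeP V (z : V) (f : V^star) :
  frechet_norm_derivative z f <->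
  (`|z + y| - `|z| - f y) / `|y| @[y --> (0 : V)^'] --> (0 : R).
Proof.
split=> [h|h].
  apply/cvgrPdist_le => e e0.
  have := h e e0; rewrite -!nbhs_nearE => he.
  apply: filterS (nbhs_dnbhs he) => s hs.
  rewrite sub0r normrN normrM normfV normr_id.
  have [->|s0] := eqVneq s 0; first by rewrite normr0 invr0 mulr0 ltW.
  by rewrite ler_pdivrMr ?normr_gt0.
move=> e e0; move/cvgrPdist_le : h => /(_ e e0).
rewrite near_withinE; apply: filterS => s /=.
have [-> _|s0 /(_ isT)] := eqVneq s 0.
  by rewrite addr0 boundedOp0 normr0 mulr0 subrr subr0 normr0.
by rewrite sub0r normrN normrM normfV normr_id ler_pdivrMr ?normr_gt0.
Qed.

(** Uniqueness of [f] follows from differentiability: another norming [g] satisfies [g (t s) <= |z +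
    t s| - |z| <= f (t s) + e t |s|] for small [t > 0], hence [g <= f], and then [g = f] by passing
    to [- s]. *)
Lemma frechet_smooth_pointP V (z : V) (f : V^star) : norming z f -> z != 0 ->
  frechet_norm_derivative z f -> frechet_smooth_point z.
Proof.
move=> nf z0 df; split; last by exists f => //; exact/frechet_norm_derivativeP.
split=> //; exists f; split=> // g [g1 gz].
have le_gf s : g s <= f s.
  apply/ler_addgt0Pl => e e0.
  have [->|s0] := eqVneq s 0; first by rewrite !boundedOp0 addr0 ltW.
  have sp : 0 < `|s| by rewrite normr_gt0.
  have /df/nbhs_ballP[r /= r0 hr] : 0 < e / `|s| by rewrite divr_gt0.
  (* This makes the norm of [t *: s] equal to [r / 2], inside the ball of radius [r]. *)
  pose t := r / 2 / `|s|; have t0 : 0 < t by rewrite !divr_gt0.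
  have := hr (t *: s); rewrite -ball_normE/= sub0r normrN normrZ gtr0_norm//.
  move=> hr'; have hz : t * `|s| < r.
    by rewrite divfK ?gt_eqF// ltr_pdivrMr// ltr_pMr// ltr1n.
  move/hr' : hz.
  rewrite ler_norml => /andP[_ hz].
  have := functional_le_norm g (z + t *: s).
  rewrite g1 mul1r boundedOpD gz boundedOpZ /= => h1.
  move: hz; rewrite boundedOpZ mulrCA divfK ?gt_eqF// => h2.
  rewrite -(ler_pM2l t0) mulrDr.
  by move: h1 h2; rewrite /GRing.scale /=; lra.
apply: boundedOp_ext => s; apply/eqP; rewrite eq_le le_gf andbT.
by have := le_gf (- s); rewrite !boundedOpN lerN2.
Qed.

(** Near [v] the norm is [w |-> |A w|], so its derivative is that of the norm at [A v] composed with
    [A]; [|A| <= 1] keeps the error term under control. *)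
Lemma frechet_smooth_point_transfer V W (A : boundedOp V W) v r : 0 < r ->
  `|A| <= 1 -> (forall s, `|s| <= r -> `|v + s| = `|A (v + s)|) ->
  frechet_smooth_point (A v) -> frechet_smooth_point v.
Proof.
move=> r0 A1 Avs [[Av0 _] [F nF /frechet_norm_derivativeP dF]].
have Av : `|A v| = `|v|.
  by have := Avs 0; rewrite addr0 normr0 => /(_ (ltW r0)).
have v0 : v != 0 by rewrite -normr_eq0 -Av normr_eq0.
apply: (frechet_smooth_pointP (adjoint_norming A1 Av v0 nF)) => // e e0.
have /nbhs_ballP[d /= d0 hd] := dF e e0.
apply/nbhs_ballP; exists (Num.min d r) => /=; first by rewrite lt_min d0.
move=> s; rewrite -ball_normE/= sub0r normrN lt_min => /andP[sd sr].
have As : `|A s| <= `|s|.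
  by apply: le_trans (op_ler_norm _ _) _; rewrite ler_piMl.
have := hd (A s); rewrite -ball_normE/= sub0r normrN (le_lt_trans As)// => /(_ isT).
rewrite (Avs s (ltW sr)) -Av boundedOpD.
by move/le_trans; apply; rewrite ler_wpM2l// ltW.
Qed.

End SmoothTransfer.

(** * Extreme points of the unit ball of L1 *)

Section L1.
Context {R : realType} (d : measure_display) (T : measurableType d).

Lemma measurable_sg : measurable_fun setT (Num.sg : R -> R).
Proof.
have -> : (Num.sg : R -> R) = (\1_`]0, +oo[ : R -> R) \- (\1_`]-oo, 0[ : R -> R).
  apply/funext => x /=; rewrite !indicE !mem_setE !in_itv/= andbT.
  have [x0|x0|->] := ltrgt0P x; last by rewrite sgr0 subrr.
    by rewrite gtr0_sg // subr0.
  by rewrite ltr0_sg // sub0r.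
by apply: measurable_funB; exact: measurable_indic.
Qed.

Context (mu : {measure set T -> \bar R}).

Lemma Lspace_class (h : T -> R) : mu.-integrable setT (EFin \o h) ->
  exists H : LspaceType1 mu, (H : T -> R) = h %[ae mu].
Proof.
move=> ih.
have mh : measurable_fun setT (h : T -> measurableTypeR R).
  by have /measurable_EFinP := measurable_int mu ih.
pose m := isMeasurableFun.Build d _ T (measurableTypeR R) h mh.
pose hf : {mfun T >-> measurableTypeR R} := HB.pack h m.
pose q : {mfun_ mu, T >-> measurableTypeR R} :=
  (\pi_({mfun_ mu, T >-> measurableTypeR R}) hf)%qT.
have qh : (q : T -> R) = h %[ae mu].
  have /eqmodP := reprK q.
  by move=> /asboolP.
have fq : finite_norm mu 1 q.
  rewrite /finite_norm Lnorm1.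
  have /integrableP[_] := ih; apply: le_lt_trans.
  rewrite le_eqVlt; apply/orP; left; apply/eqP.
  apply: ae_eq_integral => //.
  - apply: measurableT_comp => //; apply/measurable_EFinP.
    by have := @measurable_funPT _ _ _ _ (repr q).
  - by apply: measurableT_comp => //; exact/measurable_EFinP.
  - by apply: filterS qh => t /[apply] /= ->.
pose mq := isFinLebesgue.Build d T R mu 1%E (lexx 1%E) q fq.
pose H : LspaceType1 mu := HB.pack_for (LspaceType1 mu) q mq.
exists H; exact: qh.
Qed.

Local Notation "E '^star'" := (boundedOp E R^o) (at level 2, format "E '^star'").

(** An isometry onto L1 seen through representatives, so that only functions, integrals and almost
    everywhere equalities remain. *)
Definition L1_coordinates (V : normedModType R) (J : V -> T -> R) :=
  [/\ forall v, measurable_fun setT (J v),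
      forall a u v, J (a *: u + v) = (fun t => a * J u t + J v t) %[ae mu],
      forall v, (\int[mu]_t `|J v t|%:E = `|v|%:E)%E
    & forall h, mu.-integrable setT (EFin \o h) -> exists v, J v = h %[ae mu]].

Lemma isometric_to_L1_coordinates (V : normedModType R) :
  isometric_to_L1 V mu -> exists J : V -> T -> R, L1_coordinates J.
Proof.
move=> [J [Jlin Jnorm Jsurj]]; exists (fun v => J v : T -> R); split => //.
- by move=> v; have := @measurable_funPT _ _ _ _ (repr (LebesgueSpace.sort (J v))).
- by move=> v; rewrite -Jnorm Lnorm1.
- move=> h /Lspace_class[H Hh]; have [v vH] := Jsurj H.
  by exists v; rewrite vH.
Qed.

(** * The l1-summand spanned by an extreme point *)

Section LSummand.
Variables (V : normedModType R) (J : V -> T -> R).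
Hypothesis hJ : L1_coordinates J.

Let Jmeas v : measurable_fun setT (J v). Proof. by case: hJ. Qed.
Let Jlin a u v : \forall t \ae mu, J (a *: u + v) t = a * J u t + J v t.
Proof. by have [_ /(_ a u v) + _ _] := hJ; apply: filterS => t /(_ I). Qed.
Let Jnorm v : (\int[mu]_t `|J v t|%:E = `|v|%:E)%E. Proof. by case: hJ. Qed.

Let Jint v : mu.-integrable setT (EFin \o J v).
Proof.
apply/integrableP; split; first exact/measurable_EFinP.
by rewrite Jnorm ltry.
Qed.

Let J0 : \forall t \ae mu, J 0 t = 0.
Proof.
apply: filterS (Jlin 1 0 0) => t; rewrite scaler0 addr0.
by lra.
Qed.

Let JZ a v : \forall t \ae mu, J (a *: v) t = a * J v t.
Proof.
apply: filterS2 J0 (Jlin a v 0) => t; rewrite addr0 => -> ->.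
by rewrite addr0.
Qed.

(** [u] is a preimage of [\1_A * J v] and [w] is [v - u]; the norms add because the supports are
    disjoint. *)
Lemma L1_restriction (A : set T) v : measurable A ->
  exists u w, [/\ v = u + w, `|u| + `|w| = `|v|,
    \forall t \ae mu, J u t = \1_A t * J v t &
    \forall t \ae mu, J w t = (1 - \1_A t) * J v t].
Proof.
move=> mA; have [_ _ _ Jsurj] := hJ.
have mA1 : measurable_fun setT (\1_A : T -> R) by exact: measurable_indic.
have [u uE] : exists u, J u = (fun t => \1_A t * J v t) %[ae mu].
  apply: Jsurj; apply: le_integrable (Jint v) => //.
    by apply/measurable_EFinP; exact: measurable_funM.
  move=> t _ /=; rewrite lee_fin normrM ler_piMl// indicE.
  by case: (t \in A); rewrite ?normr1 ?normr0.
have {}uE : \forall t \ae mu, J u t = \1_A t * J v t.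
  by apply: filterS uE => t /(_ I).
have wE : \forall t \ae mu, J (- 1 *: u + v) t = (1 - \1_A t) * J v t.
  by apply: filterS2 uE (Jlin (- 1) u v) => t -> ->; ring.
exists u, (- 1 *: u + v); split => //.
  by rewrite scaleN1r addrA subrr add0r.
apply: EFin_inj; rewrite EFinD -!Jnorm -ge0_integralD//; last 2 first.
- by apply/measurable_EFinP; exact: measurableT_comp.
- by apply/measurable_EFinP; exact: measurableT_comp.
apply: ae_eq_integral => //.
- by apply/measurable_EFinP; apply: measurable_funD; exact: measurableT_comp.
- by apply/measurable_EFinP; exact: measurableT_comp.
apply: filterS2 uE wE => t -> -> _; rewrite -EFinD; congr EFin.
rewrite indicE; case: (t \in A); rewrite /= ?subrr ?subr0 ?mul1r ?mul0r.
  by rewrite normr0 addr0.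
by rewrite normr0 add0r.
Qed.

Variable e : V.
Hypotheses (e1 : `|e| = 1)
  (e_extreme : forall u v, e = u + v -> `|u| + `|v| = 1 -> u = `|u| *: e).

(** Splitting [e] along [A], extremality makes the part carried by [A] equal to [|u| *: e]: either
    [|u| = 0] and [e] vanishes on [A], or [e] vanishes off [A]. *)
Let extreme_atom (A : set T) : measurable A ->
  (\forall t \ae mu, A t -> J e t = 0) \/
  (\forall t \ae mu, ~ A t -> J e t = 0).
Proof.
move=> mA; have [u [w [euw nuw uE _]]] := L1_restriction e mA.
have ue := e_extreme euw (etrans nuw e1).
have [u0|u0] := eqVneq `|u| 0.
  left; have := J0; rewrite ue u0 scale0r in uE.
  apply: filterS2 uE => t -> /[swap] At; rewrite indicE mem_set// mul1r.
  exact.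
right; have := JZ `|u| e; rewrite -ue.
apply: filterS2 uE => t -> /[swap] At; rewrite indicE memNset// mul0r.
by move=> /esym/eqP; rewrite mulf_eq0 (negbTE u0) => /eqP.
Qed.

Let s t : R := Num.sg (J e t).

Let sJ v t : R := s t * J v t.

Let s_measurable : measurable_fun setT s.
Proof. exact: measurableT_comp measurable_sg (Jmeas e). Qed.

Let sJ_measurable v : measurable_fun setT (sJ v).
Proof. exact: measurable_funM. Qed.

Let sJ_le v t : `|sJ v t| <= `|J v t|.
Proof. by rewrite normrM normr_sg ler_piMl//; case: (_ == _). Qed.

Let sJ_int v : mu.-integrable setT (EFin \o sJ v).
Proof.
apply: le_integrable (Jint v) => //; first exact/measurable_EFinP.
by move=> t _; rewrite /= lee_fin sJ_le.
Qed.

(** The norming functional of [e] given by integration against the sign of [J e]; it is the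
    projection coefficient onto the line of [e]. *)
Let p v : R^o := \int[mu]_t sJ v t.

Let p_linear : linear p.
Proof.
move=> a u v; transitivity (a * p u + p v : R); last by [].
have iau : mu.-integrable setT (EFin \o (fun t => a * sJ u t)).
  by have := integrableZl measurableT a (sJ_int u).
rewrite /p -RintegralZl// -RintegralD//.
rewrite /Rintegral; congr fine; apply: ae_eq_integral => //.
- exact/measurable_EFinP.
- apply/measurable_EFinP; apply: measurable_funD => //.
  by apply: measurable_funM.
- apply: filterS (Jlin a u v) => t; rewrite /sJ => -> _.
  by congr EFin; ring.
Qed.

Let p_bounded v : `|p v| <= 1 * `|v|.
Proof.
rewrite mul1r; apply: le_trans (le_normr_Rintegral _ _) _ => //.
rewrite -lee_fin -Jnorm /Rintegral fineK.
  apply: ge0_le_integral => //.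
  - by apply/measurable_EFinP; exact: measurableT_comp.
  - by apply/measurable_EFinP; exact: measurableT_comp.
  - by move=> t _; rewrite lee_fin.
rewrite integrable_fin_num//.
by have := integrable_abse (sJ_int v).
Qed.

Let pe : p e = 1.
Proof.
rewrite /p /Rintegral -[RHS]/(fine 1%:E) -e1 -Jnorm; congr fine.
by apply: eq_integral => t _; rewrite /sJ /s -normrEsg.
Qed.

(* The integral of [sJ v] vanishes and, [e] being carried by an atom, [sJ v]
   has constant sign almost everywhere. *)
Let p_eq0 v : p v = 0 -> \forall t \ae mu, J e t != 0 -> J v t = 0.
Proof.
move=> pv0; pose A := [set t | 0 < sJ v t].
have mA : measurable A.
  rewrite -[A]setTI (_ : A = sJ v @^-1` `]0, +oo[).
    exact: sJ_measurable.
  by apply/seteqP; split=> t /=; rewrite in_itv/= andbT.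
suff : ae_eq mu setT (EFin \o sJ v) (cst 0%E).
  apply: filterS => t /(_ I) /= -[] /eqP; rewrite mulf_eq0 sgr_eq0.
  by case/orP => [->//|/eqP].
apply/ae_eq_integral_abs => //; first exact/measurable_EFinP.
(* [c] is the constant sign, so the integral of the absolute value is [c * p v = 0]. *)
have intE c : (\forall t \ae mu, `|sJ v t| = c * sJ v t) ->
    (\int[mu]_t `|(EFin \o sJ v) t| = 0)%E.
  move=> h; rewrite (@ae_eq_integral _ _ _ _ _ (fun t => (c * sJ v t)%:E))//.
  - have -> : (fun t => (c * sJ v t)%:E) =
        (fun t => c%:E * (EFin \o sJ v) t)%E by [].
    rewrite integralZl// -(fineK (integrable_fin_num _ (sJ_int v)))//.
    by rewrite -/(Rintegral _ _ _) -/(p v) pv0 mule0.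
  - by apply/measurable_EFinP; exact: measurableT_comp.
  - by apply/measurable_EFinP; apply: measurable_funM.
  - by apply: filterS h => t /= -> _.
have [h|h] := extreme_atom mA.
- apply: (intE (-1)); apply: filterS h => t h; have [h0|h0] := leP (sJ v t) 0.
    by rewrite ler0_norm// mulN1r.
  by have := h0; rewrite /sJ /s (h h0) sgr0 mul0r ltxx.
- apply: (intE 1); apply: filterS h => t h; have [h0|h0] := leP (sJ v t) 0.
    have nA : ~ A t by apply/negP; rewrite -leNgt.
    by rewrite mul1r /sJ /s (h nA) sgr0 mul0r normr0.
  by rewrite gtr0_norm// mul1r.
Qed.

(** The component [n = v - p v *: e] lies in the kernel of [p], so [J n] vanishes almost everywhere
    on the support of [J e], and the norms of the two components add. *)
Lemma L1_extreme_L_summand : exists q : V^star,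
  q e = 1 /\ forall v, `|v| = `|q v| + `|v - q v *: e|.
Proof.
exists (mk_op p_linear p_bounded); split=> [//|v /=].
pose n := v - p v *: e.
have pn : p n = 0.
  rewrite /n addrC -scaleN1r scalerA p_linear pe -[_ *: _]/(_ * _).
  by rewrite mulr1 mulN1r addNr.
have nE : \forall t \ae mu, J n t = J v t - p v * J e t.
  rewrite /n addrC -scaleN1r scalerA; apply: filterS (Jlin (-1 * p v) e v) => t ->.
  by rewrite mulN1r mulNr addrC.
rewrite -/n -[`|p v|]mulr1 -e1; apply: EFin_inj.
rewrite EFinD EFinM -!Jnorm -ge0_integralZl//; last first.
  by apply/measurable_EFinP; exact: measurableT_comp.
rewrite -ge0_integralD//; last 2 first.
- by apply: emeasurable_funM => //; apply/measurable_EFinP; exact: measurableT_comp.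
- by apply/measurable_EFinP; exact: measurableT_comp.
apply: ae_eq_integral => //.
- by apply/measurable_EFinP; exact: measurableT_comp.
- apply/measurable_EFinP; apply: measurable_funD; last exact: measurableT_comp.
  by apply: measurable_funM => //; exact: measurableT_comp.
apply: filterS2 (p_eq0 pn) nE => t h1 h2 _; rewrite -EFinM -EFinD -normrM.
have [e0|/h1 n0] := eqVneq (J e t) 0.
  by rewrite h2 e0 mulr0 normr0 add0r subr0.
by rewrite n0 normr0 addr0; congr (`|_|%:E); move: h2; rewrite n0; lra.
Qed.

End LSummand.
End L1.

(** * Weak-star cluster points *)

Section Cluster.
Context {R : realType}.
Local Notation "E '^star'" := (boundedOp E R^o) (at level 2, format "E '^star'").

(** Compactness of [[- C, C]] provides a cluster point, and an ultrafilter converges to each of its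
    cluster points. *)
Lemma ultra_bounded_cvg (U : set_system nat) (u : nat -> R) C :
  UltraFilter U -> (forall n, `|u n| <= C) -> cvg (u @ U).
Proof.
move=> ultraU uC.
have uU : (u @ U) `[- C, C]%classic.
  have -> : (u @ U) `[- C, C]%classic = U setT.
    congr U; apply/seteqP; split=> // n _ /=.
    by rewrite in_itv/= -ler_norml.
  exact: filterT.
have [l [_ ul]] := @segment_compact R (- C) C (u @ U) _ uU.
apply/cvg_ex; exists l => B lB.
have [//|UB] := in_ultra_setVsetC (u @^-1` B) ultraU.
by have [x [/= nBx Bx]] := ul (~` B) B UB lB.
Qed.

(** [Psi] is the limit along an ultrafilter finer than [\oo]: it exists at every functional by
    boundedness and agrees with ordinary limits whenever they exist. *)
Lemma bidual_cluster (V : normedModType R) (z : nat -> V) :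
  (forall n, `|z n| <= 1) ->
  exists2 Psi : V^star^star, `|Psi| <= 1 &
    forall (f : V^star) (l : R), f (z n) @[n --> \oo] --> l -> Psi f = l.
Proof.
move=> z1; have [U [ultraU sub]] := @ultraFilterLemma nat \oo _.
have fz1 (f : V^star) n : `|f (z n) : R| <= `|f|.
  by apply: le_trans (op_ler_norm f (z n)) _; rewrite ler_piMr.
have cf (f : V^star) : cvg ((fun n => f (z n) : R) @ U).
  exact: ultra_bounded_cvg (fz1 f).
pose L (f : V^star) : R^o := lim ((fun n => f (z n) : R) @ U).
have Llin : linear L.
  move=> a f g; apply: cvg_lim; first exact: Rhausdorff.
  by apply: cvgD; [apply: cvgMr; exact: (cf f)|exact: (cf g)].
have Lb f : `|L f| <= 1 * `|f|.
  rewrite mul1r ler_norml; apply/andP; split.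
    apply: limr_ge; first exact: cf.
    by apply: nearW => n; have := fz1 f n; rewrite ler_norml => /andP[].
  apply: limr_le; first exact: cf.
  by apply: nearW => n; have := fz1 f n; rewrite ler_norml => /andP[].
exists (mk_op Llin Lb); first exact: op_norm_le.
move=> f l fl; apply: cvg_lim; first exact: Rhausdorff.
exact: cvg_trans (cvg_app _ sub) fl.
Qed.
End Cluster.

(** * Smooth points of the space of compact operators *)

Section Main.
Context {R : realType}.
Local Notation "E '^star'" := (boundedOp E R^o) (at level 2, format "E '^star'").
Implicit Types X Y : normedModType R.

(** The map [S |-> S* g] on compact operators. *)
Definition pullback X Y (g : Y^star) : boundedOp (compactOp X Y) (X^star) :=
  comp_op (postcomp X g) (compact_incl X Y).

Lemma norm_pullback X Y (g : Y^star) : `|pullback X g| <= `|g|.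
Proof.
apply: le_trans (norm_comp_op _ _) _; rewrite -[leRHS]mulr1.
by apply: ler_pM => //; [exact: norm_postcomp|exact: norm_compact_incl].
Qed.

(** By compactness the norm attains its maximum on the closure of the image of the ball, at some
    [y0]; any [e] norming [y0] works. As [y0] need not be a value of [T], it is approximated by
    values. *)
Lemma compactOp_norming_functional X Y (T : compactOp X Y) : T != 0 ->
  exists e : Y^star, `|e| = 1 /\ `|pullback X e T| = `|T|.
Proof.
move=> T0; have Tp : 0 < `|T| by rewrite normr_gt0.
set K := closure (T @` [set x : X | `|x| <= 1]).
have cK : compact K by have /asboolP := compactOpP T; rewrite precompactE.
have K0 : K !=set0.
  by exists (T 0); apply: subset_closure; exists 0 => //=; rewrite normr0.
have [|y0] := @compact_EVT_max _ R (fun y : Y => `|y|) K K0 cK.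
  by apply: continuous_subspaceT; exact: norm_continuous.
rewrite inE => Ky0 y0max.
have Ty0 : `|T| <= `|y0|.
  apply: opnorm_le => x x1; apply: y0max; rewrite inE.
  by apply: subset_closure; exists x.
have y00 : y0 != 0 by rewrite -normr_gt0 (lt_le_trans Tp).
have [e [e1 ey0]] := norming_exists y00; exists e; split=> //.
apply/eqP; rewrite eq_le; apply/andP; split.
  apply: le_trans (op_ler_norm _ _) _; rewrite ler_piMl//.
  by rewrite (le_trans (norm_pullback _ _))// e1.
apply/ler_addgt0Pr => r r0.
have [_ [[x /= x1 <-] Tx]] := Ky0 _ (nbhsx_ballx y0 r r0).
move: Tx; rewrite -ball_normE /= => Tx.
have h1 := functional_le_norm e (y0 - T x); rewrite boundedOpB ey0 e1 mul1r in h1.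
have h2 := functional_le_norm (pullback X e T) x.
have h3 : `|pullback X e T| * `|x| <= `|pullback X e T| by rewrite ler_piMr.
by move: h2 h3 h1 Tx Ty0 => /=; lra.
Qed.

Section Smooth.
Variables (X Y : normedModType R) (T : compactOp X Y) (e : Y^star).
Hypotheses (sT : smooth_point T) (e1 : `|e| = 1) (eT : `|pullback X e T| = `|T|).

Let T0 : T != 0. Proof. by case: sT. Qed.
Let Tgt0 : 0 < `|T|. Proof. by rewrite normr_gt0. Qed.
Let eT0 : pullback X e T != 0. Proof. by rewrite -normr_eq0 eT normr_eq0. Qed.

Let norming_tensor (g : Y^star) (F : X^star^star) : `|g| <= 1 -> `|F| = 1 ->
  F (pullback X g T) = `|T| -> norming T (adjoint (pullback X g) F).
Proof.
move=> g1 F1 FT; apply: norming_of_le => //.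
apply: le_trans (norm_comp_op _ _) _; rewrite F1 mul1r.
exact: le_trans (norm_pullback _ _) g1.
Qed.

(** If [F] norms [T* e], the bounds [F (T* u) <= |u| |T|] and [F (T* v) <= |v| |T|] add up to an
    equality, so both are equalities. Then [u / |u|] and [e] give two functionals norming [T], which
    coincide by smoothness. *)
Lemma smooth_norming_extreme (u v : Y^star) :
  e = u + v -> `|u| + `|v| = 1 -> u = `|u| *: e.
Proof.
move=> euv nuv; have [u0|u0] := eqVneq u 0; first by rewrite u0 normr0 scale0r.
have up : 0 < `|u| by rewrite normr_gt0.
have [F [F1 FeT]] := norming_exists eT0.
have Fle (g : Y^star) : F (pullback X g T) <= `|g| * `|T|.
  apply: le_trans (functional_le_norm F _) _; rewrite F1 mul1r.
  by apply: le_trans (op_ler_norm _ _) _; rewrite ler_wpM2r// norm_pullback.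
have eT_uv : pullback X e T = pullback X u T + pullback X v T.
  by apply: boundedOp_ext => x; rewrite euv.
have FuT : F (pullback X u T) = `|u| * `|T|.
  apply/eqP; rewrite eq_le Fle/=.
  have := Fle v; move: FeT; rewrite eT eT_uv boundedOpD.
  have -> : `|v| = 1 - `|u| by rewrite -nuv addrAC subrr add0r.
  by rewrite mulrBl mul1r /=; lra.
pose w : Y^star := `|u|^-1 *: u.
have w1 : `|w| = 1 by rewrite normrZ normfV normr_id mulVf ?gt_eqF.
have FwT : F (pullback X w T) = `|T|.
  have -> : pullback X w T = `|u|^-1 *: pullback X u T by exact: boundedOp_ext.
  by rewrite boundedOpZ FuT -[_ *: _]/(_ * _) mulKf// gt_eqF.
have [_ [f [_ funi]]] := sT.
have wE : adjoint (pullback X w) F = adjoint (pullback X e) F.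
  rewrite -(funi _ (norming_tensor _ F1 FwT)) ?w1//.
  by apply: (funi _ (norming_tensor _ F1 _)); rewrite ?e1// -eT.
suff we : w = e by rewrite -we scalerA mulfV ?gt_eqF// scale1r.
(* Testing on the rank-one operator [x |-> (T* e) x *: y] gives [w y * |T| = e y * |T|]. *)
apply: boundedOp_ext => y.
have := congr1 (fun h : (compactOp X Y)^star =>
  h (rank_one (pullback X e T) y)) wE => /=.
have pE (g : Y^star) :
    comp_op g (rank_one (pullback X e T) y) = g y *: pullback X e T.
  by apply: boundedOp_ext => x /=; rewrite boundedOpZ; exact: mulrC.
rewrite !pE !boundedOpZ FeT eT; apply: mulIf.
by rewrite gt_eqF.
Qed.

Lemma very_smooth_norm_gap (p : Y^star^star) :
  smooth_point (bidual_embedding T) -> p e = 1 ->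
  exists2 c, c < `|T| & forall (n : Y^star) x, p n = 0 -> `|x| <= 1 ->
    n (T x) <= c * `|n|.
Proof.
move=> [T20 [G [_ Guni]]] pe.
apply: contrapT => nogap.
(* Without a gap, each [c = |T| - 1 / (k + 1)] fails at some [n] in the kernel of [p], which is then
   normalised. *)
have /choice[nx nxP] k : exists nx : Y^star * X,
    [/\ p nx.1 = 0, `|nx.1| <= 1, `|nx.2| <= 1
      & `|T| - k.+1%:R^-1 < nx.1 (T nx.2)].
  apply: contrapT => h; apply: nogap; exists (`|T| - k.+1%:R^-1).
    by rewrite gtrBl invr_gt0 ltr0n.
  move=> n x pn x1; rewrite leNgt; apply/negP => nTx.
  have n0 : n != 0 by apply: contraTneq nTx => ->; rewrite normr0 mulr0 -leNgt.
  have np : 0 < `|n| by rewrite normr_gt0.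
  apply: h; exists (`|n|^-1 *: n, x); split => //=.
  - by rewrite boundedOpZ pn scaler0.
  - by rewrite normrZ normfV normr_id mulVf ?gt_eqF.
  - by rewrite -[X in _ < X]/(`|n|^-1 * n (T x)) ltr_pdivlMl// mulrC.
(* [z k] is the functional [S |-> n_k (S x_k)]; its values at [T] tend to [|T|]. *)
pose z k : (compactOp X Y)^star :=
  adjoint (pullback X (nx k).1) (bidual_embedding (nx k).2).
have z1 k : `|z k| <= 1.
  have [_ n1 x1 _] := nxP k.
  apply: le_trans (norm_comp_op _ _) _; rewrite norm_bidual_embedding.
  by apply: mulr_ile1 => //; exact: le_trans (norm_pullback _ _) n1.
have [Psi Psi1 PsiP] := bidual_cluster z1.
have PsiT : Psi (bidual_embedding T) = `|T|.
  apply: PsiP.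
  have h : (fun k => `|T| - k.+1%:R^-1) @ \oo --> (`|T| : R).
    rewrite -[X in _ --> X]subr0; apply: cvgB; first exact: cvg_cst.
    exact: cvg_harmonic.
  apply: (squeeze_cvgr _ h); last exact: (@cvg_cst _ (`|T| : R)).
  apply: nearW => k; have [_ _ _ hk] := nxP k.
  rewrite /= (ltW hk) /=.
  by have := functional_le_norm (z k) T => /le_trans; apply; rewrite ler_piMl.
have [F [F1 FeT]] := norming_exists eT0.
have nPsi : norming (bidual_embedding T) Psi.
  by apply: norming_of_le => //; rewrite norm_bidual_embedding.
have nF := norming_tensor _ F1 (etrans FeT eT).
have [F'1 F'T] := nF (eq_ind_r (fun t => is_true (t <= 1)) (lexx 1) e1).
have nF' : norming (bidual_embedding T)
    (bidual_embedding (adjoint (pullback X e) F)).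
  apply: norming_of_le => //; first by rewrite norm_bidual_embedding F'1.
  by rewrite norm_bidual_embedding.
(* [phi |-> p (y |-> phi (f (.) y))] is 0 at [Psi] and [|T|] at the other
   functional. *)
pose f := pullback X e T.
have := congr1 (fun h : (compactOp X Y)^star^star^star =>
    h (adjoint (adjoint (rank_oner Y f)) p))
  (etrans (esym (Guni _ nPsi)) (Guni _ nF')).
rewrite (PsiP _ 0).
  have -> : bidual_embedding (adjoint (pullback X e) F)
      (adjoint (adjoint (rank_oner Y f)) p) =
    p (comp_op (comp_op F (pullback X e)) (rank_oner Y f)) by [].
  have -> : comp_op (comp_op F (pullback X e)) (rank_oner Y f) = F f *: e.
    apply: boundedOp_ext => y /=.
    have -> : comp_op e (rank_one f y) = e y *: f.
      by apply: boundedOp_ext => x /=; rewrite boundedOpZ; exact: mulrC.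
    by rewrite boundedOpZ; exact: mulrC.
  rewrite boundedOpZ pe FeT eT => /eqP.
  by rewrite -[_ *: _]/(_ * _) mulr1 eq_sym gt_eqF.
apply: cvg_near_cst; apply: nearW => k /=; have [pn _ _ _] := nxP k.
have -> : comp_op (z k) (rank_oner Y f) = f (nx k).2 *: (nx k).1.
  by apply: boundedOp_ext => y /=; rewrite boundedOpZ.
by rewrite boundedOpZ pn scaler0.
Qed.

(** A functional [g] norming [y = (T + S) x] splits as [p g *: e + n] with [n] in the kernel of [p].
    Both parts are bounded at [y] by their norm times [m = |(T + S)* e|], and these norms add up to
    [|g| = 1]. *)
Lemma L_summand_norm_pullback (p : Y^star^star) c : p e = 1 ->
  (forall v : Y^star, `|v| = `|p v| + `|v - p v *: e|) ->
  (forall (n : Y^star) x, p n = 0 -> `|x| <= 1 -> n (T x) <= c * `|n|) ->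
  forall S : boundedOp X Y, `|S| <= (`|T| - c) / 2 ->
  `|(T : boundedOp X Y) + S| = `|postcomp X e ((T : boundedOp X Y) + S)|.
Proof.
move=> pe pL gap S Sr; apply/eqP; rewrite eq_le; apply/andP; split; last first.
  by apply: le_trans (op_ler_norm _ _) _; rewrite ler_piMl// -e1 norm_postcomp.
set m := `|postcomp X e _|.
have mge : `|T| - `|S| <= m.
  rewrite -eT /m boundedOpD; apply: le_trans (lerB_normD _ _).
  rewrite lerD2l lerN2; apply: le_trans (op_ler_norm _ _) _.
  by rewrite ler_piMl// -e1 norm_postcomp.
apply: opnorm_le => x x1; pose y := (compactOp_op T + S) x; rewrite -/y.
have [->|y0] := eqVneq y 0; first by rewrite normr0 /m normr_ge0.
have [g [g1 gy]] := norming_exists y0.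
pose n := g - p g *: e.
have pn : p n = 0.
  by rewrite /n boundedOpB boundedOpZ pe -[_ *: _]/(_ * _) mulr1 subrr.
have nSx : n (S x) <= `|n| * `|S|.
  apply: le_trans (functional_le_norm n _) _; rewrite ler_wpM2l//.
  by apply: le_trans (op_ler_norm _ _) _; rewrite ler_piMr.
have ny : n y <= `|n| * m.
  have -> : n y = n (T x) + n (S x) by rewrite -boundedOpD.
  apply: le_trans (lerD (gap n x pn x1) nSx) _.
  (* The radius [(|T| - c) / 2] is what gives [c + |S| <= |T| - |S| <= m]. *)
  rewrite mulrC -mulrDr ler_wpM2l//; lra.
have ey : p g * e y <= `|p g| * m.
  apply: le_trans (ler_norm _) _; rewrite normrM ler_wpM2l//.
  have eym : `|e y| <= m * `|x|.
    exact: (op_ler_norm (postcomp X e (compactOp_op T + S)) x).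
  by apply: le_trans eym _; rewrite ler_piMr /m ?normr_ge0.
have gE : g y = p g * e y + n y.
  have -> : n y = g y - p g * e y by [].
  by rewrite addrC subrK.
rewrite -gy gE -[leRHS]mul1r -g1 (pL g) mulrDl.
by apply: lerD.
Qed.

End Smooth.
End Main.

Theorem theorem11 (R : realType) (X Y : completeNormedModType R)
    (hX : forall f : boundedOp X R^o, very_smooth_point f -> frechet_smooth_point f)
    (hY : L1_predual Y)
    (T : compactOp X Y) (hT : very_smooth_point T) :
  frechet_smooth_point (T : boundedOp X Y).
Proof.
have [sT sT2] := hT; have T0 : T != 0 by case: sT.
have [e [e1 eT]] := compactOp_norming_functional T0.
have [d [Om [mu /isometric_to_L1_coordinates[J hJ]]]] := hY.
have [p [pe pL]] := L1_extreme_L_summand hJ e1 (smooth_norming_extreme sT e1 eT).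
have [c cT gap] := very_smooth_norm_gap sT e1 eT sT2 pe.
have r0 : 0 < (`|T| - c) / 2 by rewrite divr_gt0// subr_gt0.
have e0 : e != 0 by rewrite -normr_eq0 e1 oner_eq0.
(* [y0] provides the right inverse of [pullback X e] used to transfer very smoothness. *)
have [y0 ey0] : exists y, e y = 1.
  have [y ey] : exists y, e y != 0.
    apply: contrapT => h; move/eqP: e0; apply; apply: boundedOp_ext => y.
    by apply: contrapT => /eqP ey; apply: h; exists y.
  by exists ((e y)^-1 *: y); rewrite boundedOpZ -[_ *: _]/(_ * _) mulVf.
(* Differentiability is lifted from [T* e] to the space of all bounded operators, whereas very
   smoothness of [T* e] comes from the space of compact operators. *)
apply: (frechet_smooth_point_transfer r0 (A := postcomp X e)).
- by rewrite -e1 norm_postcomp.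
- by have := L_summand_norm_pullback e1 eT pe pL gap.
apply: hX.
apply: (@very_smooth_point_transfer _ _ _ (pullback X e) (rank_onel X y0)) => //.
- by rewrite -e1 norm_pullback.
- move=> f; apply: boundedOp_ext => x /=.
  by rewrite boundedOpZ ey0 -[_ *: _]/(_ * _) mulr1.
Qed.
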